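(* Every finite $SP$-group is a $CH$-group. That is, $SP\subset CH$, where $SP$ and $CH$ denote the classes of finite $SP$-groups and finite $CH$-groups respectively.
   Context: For a finite group $G$, $Z(G)$ denotes its center and $C_G(x)$ the centralizer of $x$ in $G$. A finite group $G$ is called an $SP$-group if for all $x,y\in G\setminus Z(G)$, $|C_G(x)|$ divides $|C_G(y)|$ implies $|C_G(x)|=|C_G(y)|$. (Equivalently, no conjugacy class size of $G$ greater than $1$ properly divides another conjugacy class size of $G$.) A finite group $G$ is called a $CH$-group if for all $x,y\in G\setminus Z(G)$, $xy=yx$ implies $|C_G(x)|=|C_G(y)|$. *)

(* Defs.v *)
From mathcomp Require Import all_boot all_fingroup all_solvable.

Set Implicit Arguments.
Unset Strict Implicit.
Unset Printing Implicit Defensive.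

Local Open Scope group_scope.

Definition SP_group (gT : finGroupType) (G : {group gT}) : Prop :=
  forall x y : gT, x \in G :\: 'Z(G) -> y \in G :\: 'Z(G) ->
    #|'C_G[x]| %| #|'C_G[y]| -> #|'C_G[x]| = #|'C_G[y]|.

Definition CH_group (gT : finGroupType) (G : {group gT}) : Prop :=
  forall x y : gT, x \in G :\: 'Z(G) -> y \in G :\: 'Z(G) ->
    x * y = y * x -> #|'C_G[x]| = #|'C_G[y]|.

(* Main.v *)
Require Import Defs.
From mathcomp Require Import all_boot all_fingroup all_solvable.

(** In an SP-group, an inclusion between centralizers of noncentral elements is
    an equality.  Hence a noncentral element has the same centralizer as each of
    its noncentral primary parts, and commuting noncentral elements u, v of
    coprime orders satisfy C(u) = C(uv) = C(v).  Through these equalities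
    everything reduces to commuting p-elements u, v such that all p'-elements of
    C(u) and of C(v) are central; then |C(u)| and |C(v)| both have the p'-part
    of |Z(G)|, so one divides the other. *)

Set Implicit Arguments.
Unset Strict Implicit.
Unset Printing Implicit Defensive.

Local Open Scope group_scope.

Lemma cent1_constt_sub (gT : finGroupType) (G : {group gT}) (pi : nat_pred)
    (x : gT) : 'C_G[x] \subset 'C_G[x.`_pi].
Proof.
apply/subsetP=> z /setIP[Gz /cent1P cxz].
rewrite inE Gz; apply/cent1P; apply: commuteX; exact: cxz.
Qed.

(** An element is the product of its primary parts, so it would be central if all of them were. *)
Lemma noncentral_constt (gT : finGroupType) (G : {group gT}) (x : gT) :
  x \in G :\: 'Z(G) -> exists p : nat, x.`_p \in G :\: 'Z(G).
Proof.
case/setDP=> Gx; rewrite -{1}(prod_constt x) => nZx.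
have [/existsP[p nZp] | ] :=
  boolP [exists p : 'I_#[x].+1, x.`_(p : nat) \notin 'Z(G)].
  by exists p; rewrite inE nZp groupX.
rewrite negb_exists => /forallP Zx; case/negP: nZx.
rewrite big_mkord; apply: group_prod => p _.
by have := Zx p; rewrite negbK.
Qed.

(** For each prime [q] in [pi], a Sylow [q]-subgroup of [H] consists of [pi]-elements, hence lies in
    [Z]. *)
Lemma partn_card_sub_p_elt (gT : finGroupType) (pi : nat_pred)
    (Z H : {group gT}) : Z \subset H ->
  (forall z, z \in H -> pi.-elt z -> z \in Z) -> (#|H|`_pi = #|Z|`_pi)%N.
Proof.
move=> sZH piH; apply: eq_partn_from_log => // q pi_q.
apply/eqP; rewrite eqn_leq (dvdn_leq_log q (cardG_gt0 H) (cardSg sZH)) andbT.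
have [Q sylQ] := Sylow_exists q H; have [sQH qQ _] := and3P sylQ.
have sQZ : Q \subset Z.
  apply/subsetP=> z Qz; apply: piH; first exact: (subsetP sQH).
  by apply: sub_p_elt (mem_p_elt qQ Qz) => r /eqP->.
rewrite -(logn_part q #|H|) -(card_Hall sylQ).
exact: dvdn_leq_log (cardG_gt0 Z) (cardSg sQZ).
Qed.

Section SPGroup.

Variables (gT : finGroupType) (G : {group gT}).
Hypothesis spG : SP_group G.

Lemma SP_cent1_sub (x y : gT) : x \in G :\: 'Z(G) -> y \in G :\: 'Z(G) ->
  'C_G[x] \subset 'C_G[y] -> 'C_G[x] = 'C_G[y].
Proof.
move=> nZx nZy sxy; apply/eqP; rewrite eqEcard sxy /=.
by rewrite (spG nZx nZy) // cardSg.
Qed.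

Lemma SP_cent1_constt (pi : nat_pred) (x : gT) :
  x \in G :\: 'Z(G) -> x.`_pi \in G :\: 'Z(G) -> 'C_G[x] = 'C_G[x.`_pi].
Proof. by move=> nZx nZxp; apply: SP_cent1_sub => //; apply: cent1_constt_sub. Qed.

(** Both [u] and [v] are powers of [u * v], being its [pi]- and [pi^']-parts; so [u * v] is
    noncentral and its centralizer equals each of theirs. *)
Lemma SP_cent1_coprime (pi : nat_pred) (u v : gT) :
    u \in G :\: 'Z(G) -> v \in G :\: 'Z(G) ->
  pi.-elt u -> pi^'.-elt v -> commute u v -> 'C_G[u] = 'C_G[v].
Proof.
move=> nZu nZv pi_u pi'v cuv.
have uv_pi : (u * v).`_pi = u.
  by rewrite consttM // (constt_p_elt pi_u) (constt1P pi'v) mulg1.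
have uv_pi' : (u * v).`_pi^' = v.
  by rewrite consttM // (constt_p_elt pi'v) (constt1P _) ?mul1g // p_eltNK.
have nZuv : u * v \in G :\: 'Z(G).
  have [[Gu nu] [Gv _]] := (setDP nZu, setDP nZv).
  rewrite inE (groupM Gu Gv) andbT; apply: contra nu => Zuv.
  by rewrite -uv_pi groupX.
have := SP_cent1_constt (pi := pi) nZuv; rewrite uv_pi => <- //.
by have := SP_cent1_constt (pi := pi^') nZuv; rewrite uv_pi' => ->.
Qed.

(** The witness [z] links [u] to [v]: coprimality gives C(u) = C(z), so [v] commutes with [z], and
    coprimality applies again to [v] and [z]. *)
Lemma SP_cent1_p'_witness (p : nat) (u v z : gT) :
    u \in G :\: 'Z(G) -> v \in G :\: 'Z(G) -> p.-elt u -> p.-elt v ->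
    commute u v -> z \in 'C_G[u] -> p^'.-elt z -> z \notin 'Z(G) ->
  'C_G[u] = 'C_G[v].
Proof.
move=> nZu nZv p_u p_v cuv /setIP[Gz /cent1P czu] p'z nz.
have nZz : z \in G :\: 'Z(G) by rewrite inE nz.
have Cuz : 'C_G[u] = 'C_G[z] by apply: SP_cent1_coprime p_u p'z _.
rewrite Cuz; apply/esym/(SP_cent1_coprime nZv nZz p_v p'z).
have [Gv _] := setDP nZv.
have : v \in 'C_G[z] by rewrite -Cuz inE Gv; apply/cent1P.
by case/setIP=> _ /cent1P.
Qed.

Lemma SP_card_cent1_p_elt (p : nat) (u v : gT) :
    u \in G :\: 'Z(G) -> v \in G :\: 'Z(G) -> p.-elt u -> p.-elt v ->
  commute u v -> #|'C_G[u]| = #|'C_G[v]|.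
Proof.
move=> nZu nZv p_u p_v cuv.
have [/exists_inP[z Cz /andP[p'z nz]] | noU] :=
    boolP [exists z in 'C_G[u], p^'.-elt z && (z \notin 'Z(G))].
  by rewrite (SP_cent1_p'_witness nZu nZv p_u p_v cuv Cz p'z nz).
have [/exists_inP[z Cz /andP[p'z nz]] | noV] :=
    boolP [exists z in 'C_G[v], p^'.-elt z && (z \notin 'Z(G))].
  by rewrite (SP_cent1_p'_witness nZv nZu p_v p_u (esym cuv) Cz p'z nz).
have p'part w : w \in G :\: 'Z(G) ->
    ~~ [exists z in 'C_G[w], p^'.-elt z && (z \notin 'Z(G))] ->
  (#|'C_G[w]|`_p^' = #|'Z(G)|`_p^')%N.
  case/setDP=> Gw _ noW; apply: partn_card_sub_p_elt.
    apply/subsetP=> z /centerP[Gz cGz].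
    by apply/setIP; split=> //; apply/cent1P; apply: cGz.
  move=> z Cz p'z; apply: contraR noW => nz.
  by apply/exists_inP; exists z; rewrite ?p'z.
(* Once the [p']-parts agree, the orders differ only by a power of [p], so comparing exponents
   yields the divisibility that [spG] needs. *)
have dvd_C w1 w2 : w1 \in G :\: 'Z(G) -> w2 \in G :\: 'Z(G) ->
    (#|'C_G[w1]|`_p^' = #|'C_G[w2]|`_p^')%N ->
    logn p #|'C_G[w1]| <= logn p #|'C_G[w2]| -> #|'C_G[w1]| = #|'C_G[w2]|.
  move=> nZ1 nZ2 e_p' le_p; apply: spG => //.
  rewrite -(partnC p (cardG_gt0 'C_G[w1])) -(partnC p (cardG_gt0 'C_G[w2])).
  by rewrite e_p' dvdn_mul // !p_part dvdn_exp2l.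
have e_p' : (#|'C_G[u]|`_p^' = #|'C_G[v]|`_p^')%N by rewrite !p'part.
have [le_uv | /ltnW le_vu] := leqP (logn p #|'C_G[u]|) (logn p #|'C_G[v]|).
  exact: dvd_C.
exact/esym/dvd_C.
Qed.

End SPGroup.

Theorem theorem1 (gT : finGroupType) (G : {group gT}) :
  SP_group G -> CH_group G.
Proof.
move=> spG x y nZx nZy cxy.
have [p nZxp] := noncentral_constt nZx; have [q nZyq] := noncentral_constt nZy.
rewrite (SP_cent1_constt spG nZx nZxp) (SP_cent1_constt spG nZy nZyq).
have cxyc : commute x.`_p y.`_q by apply: commuteX2.
(* Parts for distinct primes have coprime orders; only a common prime needs the counting
   argument. *)
have [eqp | neq_pq] := eqVneq q p.
  rewrite eqp in nZyq cxyc *.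
  by apply: (@SP_card_cent1_p_elt _ _ spG p) => //; apply: p_elt_constt.
rewrite (@SP_cent1_coprime _ _ spG p _ _ nZxp nZyq) ?p_elt_constt //.
by apply: sub_p_elt (p_elt_constt q y) => r /eqP->.
Qed.
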